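(* Let $d\ge 2$ be fixed and let $0<a<1/8$ be a fixed constant. Consider the recovery problems ${\rm CHC}_R(\mathbf k,\mathbf n,\lambda)$ and ${\rm ROHC}_R(\mathbf k,\mathbf n,\mu)$ under regime (A1). If $$\lambda\le \max_{1\le i\le d}\sqrt{\frac{a\log(n_i-k_i)}{\prod_{z\ne i}k_z}}\qquad\Big(\text{resp. } \frac{\mu}{\sqrt{\prod_{i=1}^d k_i}}\le \max_{1\le i\le d}\sqrt{\frac{a\log(n_i-k_i)}{\prod_{z\ne i}k_z}}\Big),$$ then $$\mathcal E^s_{{\rm CHC}_R}\ \ (\text{resp. }\mathcal E^s_{{\rm ROHC}_R})\ \ge\ \frac{\sqrt M}{1+\sqrt M}\Big(1-2a-\frac{2a}{\log M}\Big)\ \longrightarrow\ 1-2a,$$ where $M=\min_i(n_i-k_i)$. Moreover, under regime (A2), if $\beta>(d-1)\alpha/2$ then $\mathcal E^s_{{\rm CHC}_R}\to1$ (resp. $\mathcal E^s_{{\rm ROHC}_R}\to 1$).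
   Context: Model: one observes an order-$d$ tensor $\mathcal Y=\mathcal X+\mathcal Z\in\mathbb R^{n_1\times\cdots\times n_d}$, where $\mathcal Z$ has i.i.d. $N(0,1)$ entries. For $I\subseteq[n]$, $\mathbf 1_I\in\mathbb R^n$ is its indicator vector; $\circ$ is the outer product. CHC class: $\mathscr X_{\rm CHC}(\mathbf k,\mathbf n,\lambda)=\{\lambda'\mathbf 1_{I_1}\circ\cdots\circ\mathbf 1_{I_d}: I_i\subseteq[n_i],|I_i|=k_i,\lambda'\ge\lambda\}$. ROHC class: $\mathscr X_{\rm ROHC}(\mathbf k,\mathbf n,\mu)=\{\mu'\mathbf v_1\circ\cdots\circ\mathbf v_d:\mathbf v_i\in\mathcal V_{n_i,k_i},\mu'\ge\mu\}$ with $\mathcal V_{n,k}=\{\mathbf v\in\mathbb S^{n-1}:\|\mathbf v\|_0\le k,\ k^{-1/2}\le|v_j|\le Ck^{-1/2}\text{ for all } j \text{ with } v_j\neq 0\}$ for a fixed $C>1$. The support $S(\mathcal X)=(I_1,\dots,I_d)$ where $I_i$ is the support of the mode-$i$ factor. Recovery risk of an estimator $\phi$ of the support: $\sup_{\mathcal X\in\mathscr X}\mathbb P_{\mathcal X}(\phi(\mathcal Y)\ne S(\mathcal X))$; $\mathcal E^s_{{\rm CHC}_R}$, $\mathcal E^s_{{\rm ROHC}_R}$ denote the infimum of this risk over all (unrestricted, possibly randomized) estimators, with $\mathscr X$ the CHC resp. ROHC class. Regime (A1): for all $i$, $n_i\to\infty$, $k_i\to\infty$, $k_i/n_i\to0$.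 Regime (A2): fixed $\alpha\in[0,1]$, $\beta\in\mathbb R$; $n\to\infty$, $n_1=\dots=n_d$ with $\log n_i/\log n\to1$, $k_1=\dots=k_d=k$ with $\log k/\log n\to\alpha$, and $\log(1/\lambda)/\log n\to\beta$ (for CHC) or $\log(\sqrt{k^d}/\mu)/\log n\to\beta$ (for ROHC).
   Formalization: Under regime (A2) the condition 0 < k < n is added: for k = n the CHC support is known, so the CHC risk is 0 and the claimed limit 1 fails; the ROHC case k = n follows from k = n-1 (slightly smaller C) by inclusion of classes. The (A1) bound is stated for all sufficiently large indices. *)

(* Defs.v *)
From HB Require Import structures.
From mathcomp Require Import all_boot all_order all_algebra.
From mathcomp Require Import all_classical all_reals all_analysis.
Unset Printing Implicit Defensive.
Import Order.TTheory GRing.Theory Num.Theory.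
Import numFieldNormedType.Exports.
Local Open Scope classical_set_scope.
Local Open Scope ring_scope.

Notation tidx d n := {dffun forall i : 'I_d, 'I_(n i)}.
Notation tsupp d n := {dffun forall i : 'I_d, {set 'I_(n i)}}.

Section Defs.
Context {R : realType}.

Fixpoint gauss_iter (I : finType) (s : seq I) (f : (I -> R) -> \bar R)
    (z : I -> R) : \bar R :=
  match s with
  | [::] => f z
  | i :: s' => (\int[normal_prob 0 1]_t
                  gauss_iter I s' f (fun j => if j == i then t else z j))%E
  end.

(* E[f(Z)] for Z with i.i.d. N(0,1) entries indexed by the finite type I *)
Definition gaussE (I : finType) (f : (I -> R) -> \bar R) : \bar R :=
  gauss_iter I (enum I) f (fun _ => 0).

(* (possibly randomized) estimator: y |-> probability distribution phi y on S,
   Borel measurable in the observation y *)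
Definition estimator (I S : finType) (phi : (I -> R) -> S -> R) : Prop :=
  [/\ forall y s, 0 <= phi y s,
      forall y, \sum_(s : S) phi y s = 1 &
      forall s, measurable_fun [set: #|I|.-tuple R]
                  (fun t => phi (fun x => tnth t (enum_rank x)) s)].

(* P_X(phi(Y) != S0), Y = X + Z *)
Definition err_prob (I S : finType) (phi : (I -> R) -> S -> R) (X : I -> R)
    (S0 : S) : \bar R :=
  gaussE I (fun z => (\sum_(s | s != S0) phi (fun x => X x + z x) s)%:E).

(* inf over estimators of sup over the class of the recovery risk;
   the class is given as pairs (X, S(X)) *)
Definition minimax_risk (I S : finType) (cls : set ((I -> R) * S)) : \bar R :=
  ereal_inf [set ereal_sup [set err_prob I S phi p.1 p.2 | p in cls]
            | phi in [set phi : (I -> R) -> S -> R | estimator I S phi]].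

Definition chc_class (d : nat) (n k : 'I_d -> nat) (lam : R)
    : set ((tidx d n -> R) * tsupp d n) :=
  [set p | exists (l : R) (J : tsupp d n),
     [/\ lam <= l, forall i, #|J i| = k i &
         p = ((fun x : tidx d n => l * \prod_(i < d) ((x i \in J i)%:R : R)), J)]].

Definition Vset (m kk : nat) (C : R) (v : 'I_m -> R) : Prop :=
  [/\ \sum_(j < m) v j ^+ 2 = 1,
      (#|finset (fun j => v j != 0%R)| <= kk)%N &
      forall j, v j != 0 ->
        (Num.sqrt kk%:R)^-1 <= `|v j| <= C * (Num.sqrt kk%:R)^-1].

Definition rohc_class (d : nat) (n k : 'I_d -> nat) (C mu : R)
    : set ((tidx d n -> R) * tsupp d n) :=
  [set p | exists (l : R) (v : forall i : 'I_d, 'I_(n i) -> R),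
     [/\ mu <= l, forall i, Vset (n i) (k i) C (v i) &
         p = ((fun x : tidx d n => l * \prod_(i < d) v i (x i)),
              [ffun i : 'I_d => finset (fun j => v i j != 0)] : tsupp d n)]].

Definition thresh (d : nat) (n k : 'I_d -> nat) (a : R) : R :=
  \big[Order.max/0]_(i < d)
     Num.sqrt (a * ln (n i - k i)%N%:R / \prod_(z < d | z != i) (k z)%:R).

Definition Mmin (d : nat) (n k : 'I_d -> nat) : nat :=
  (\big[minn/(\max_(i < d) (n i - k i))]_(i < d) (n i - k i))%N.

Definition risk_lb (a M : R) : R :=
  Num.sqrt M / (1 + Num.sqrt M) * (1 - 2 * a - 2 * a / ln M).

Definition regimeA1 (d : nat) (n k : nat -> 'I_d -> nat) : Prop :=
  forall i : 'I_d,
    [/\ (fun m => n m i) @ \oo --> \oo,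
        (fun m => k m i) @ \oo --> \oo &
        (fun m => (k m i)%:R / (n m i)%:R : R) @ \oo --> 0].

End Defs.
Arguments regimeA1 : clear implicits.
Arguments minimax_risk {R I S} cls.

(* Main.v *)
(* All candidate supports share d - 1 modes and differ from a common base in one
   element of the remaining mode i, so each mean is B + D with
   |D|^2 = l^2 prod_(z != i) k_z =: v. If N candidates are available, some
   candidate s is guessed with probability at most 1 / N under the base mean B.
   The likelihood ratio w of B + D against B has second moment exp v, hence
   P_s(phi = s) = E_B[w; phi = s] <= t / (2 N) + exp v / (2 t) for all t > 0, and
   optimizing in t gives risk >= 1 - exp (v / 2) / sqrt N. In regime (A1)
   v = a ln (n_i - k_i), so this bound tends to 1 and eventually exceeds 1 - 2 a; in
   regime (A2) v <= 1 eventually. The rank-one tensors with flat factors embed CHC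
   with lambda = mu / sqrt (prod k_i) into ROHC. *)
Require Import Defs.
From HB Require Import structures.
From mathcomp Require Import all_boot all_order all_algebra.
From mathcomp Require Import all_classical all_reals all_analysis.
From mathcomp Require Import ring lra zify.
From mathcomp Require Import measurable_realfun.
Import Order.TTheory GRing.Theory Num.Theory.
Import numFieldNormedType.Exports.
Local Open Scope classical_set_scope.
Local Open Scope ring_scope.

(** * Translation of one-dimensional Gaussian integrals *)

Section NormalShift.
Context {R : realType}.
Local Notation mu := (@lebesgue_measure R).
Local Notation N01 := (@normal_prob R 0 1).
Local Open Scope ereal_scope.

(** Lebesgue measure and its pushforward under the shift agree on half-open intervals, which
    determine the measure. *)
Lemma ge0_integral_lebesgue_shift (c : R) (h : R -> \bar R) :
  measurable_fun [set: R] h -> (forall x, 0 <= h x) ->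
  \int[mu]_x h (x + c)%R = \int[mu]_x h x.
Proof.
move=> mh h0.
pose sh : measurableTypeR R -> measurableTypeR R := fun x => (x + c)%R.
have msh : measurable_fun setT sh by exact: measurable_funD.
rewrite [RHS](_ : _ = \int[pushforward mu sh]_(x in setT) h x); last first.
  apply: eq_measure_integral => //= A mA _.
  apply: lebesgue_measure_unique => //= _ [[a b]] _ <-.
  rewrite /pushforward (_ : sh @^-1` _ = `](a - c)%R, (b - c)%R]%classic).
    rewrite !lebesgue_measure_itv/= !lte_fin ltrD2r.
    by case: ifP => // _; rewrite -!EFinD opprB addrA subrK.
  by apply/seteqP; split => x /=; rewrite !in_itv/= ltrBlDr lerBrDr.
by rewrite ge0_integral_pushforward.
Qed.

(** The Radon-Nikodym derivative and [normal_pdf] have the same integral over every measurable set,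
    hence agree almost everywhere. *)
Lemma ge0_integral_normal_prob (m s : R) (h : R -> \bar R) :
  measurable_fun [set: R] h -> (forall x, 0 <= h x) ->
  \int[normal_prob m s]_x h x = \int[mu]_x (h x * (normal_pdf m s x)%:E).
Proof.
move=> mh h0; have dom := normal_prob_dominates m s.
rewrite -(Radon_Nikodym_SigmaFinite.change_of_variables dom)//=.
apply: ae_eq_integral => //.
- apply: emeasurable_funM => //; apply: (measurable_int mu).
  exact: Radon_Nikodym_SigmaFinite.f_integrable.
- apply: emeasurable_funM => //=; apply/measurable_EFinP.
  exact: measurable_normal_pdf.
- apply: ae_eqe_mul2l => /=.
  apply: integral_ae_eq => //=.
  + exact: Radon_Nikodym_SigmaFinite.f_integrable.
  + by apply/measurable_EFinP; exact: measurable_normal_pdf.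
  + by move=> E _ mE; rewrite -Radon_Nikodym_SigmaFinite.f_integral.
Qed.

(** One-dimensional Cameron-Martin formula: the exponential is the density of N(c, 1) with respect
    to N(0, 1). *)
Lemma ge0_integral_normal_prob_shift (c : R) (h : R -> \bar R) :
  measurable_fun [set: R] h -> (forall x, 0 <= h x) ->
  \int[N01]_x h (x + c)%R
  = \int[N01]_x (h x * (expR (c * x - c ^+ 2 / 2))%:E).
Proof.
move=> mh h0.
have msh : measurable_fun [set: R] (fun x : R => h (x + c)%R).
  by apply: (measurableT_comp mh); exact: measurable_funD.
have mw : measurable_fun [set: R] (fun x : R => (expR (c * x - c ^+ 2 / 2))%:E).
  apply/measurable_EFinP; apply: measurableT_comp => //.
  by apply: measurable_funB => //; exact: measurable_funM.
rewrite !ge0_integral_normal_prob//; last 2 first.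
- exact: emeasurable_funM.
- by move=> x; rewrite mule_ge0// lee_fin expR_ge0.
(* Shifting the right side by [c] makes the integrands equal pointwise, since pdf(x + c) exp(c (x +
   c) - c^2 / 2) = pdf(x). *)
rewrite -[RHS](ge0_integral_lebesgue_shift c); last 2 first.
- apply: emeasurable_funM; first exact: emeasurable_funM.
  by apply/measurable_EFinP; exact: measurable_normal_pdf.
- by move=> x; rewrite !mule_ge0// lee_fin ?expR_ge0// normal_pdf_ge0.
apply: eq_integral => x _; rewrite -muleA -EFinM; congr (_ * _%:E).
rewrite normal_pdfE ?oner_eq0// mulrCA -expRD; congr (_ * expR _)%R.
by rewrite !subr0 expr1n; field.
Qed.

End NormalShift.

(** * Iterated Gaussian integrals and the Cameron-Martin formula in finite dimension *)

Section GaussianExpectation.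
Context {R : realType} {I : finType}.
Local Notation N01 := (@normal_prob R 0 1).
Implicit Types (f g : (I -> R) -> \bar R) (s : seq I) (z c : I -> R).
Local Open Scope ereal_scope.

(** Measurability read through the enumeration of [I], the form in which [estimator] states it. *)
Definition fun_measurable f :=
  measurable_fun [set: #|I|.-tuple R]
    (fun t => f (fun x => tnth t (enum_rank x))).

(** Likelihood ratio of N(c, Id) against N(0, Id) on the coordinates in [s]. *)
Definition gauss_weight s c z : R :=
  (\prod_(i <- s) expR (c i * z i - c i ^+ 2 / 2))%R.

Definition upd z i (t : R) : I -> R := fun j => if j == i then t else z j.

(** The composite factors through the tuple of coordinates of [u], so measurability can be checked
    one coordinate at a time. *)
Lemma fun_measurable_comp d (T : measurableType d) f (u : T -> I -> R) :
  fun_measurable f -> (forall i, measurable_fun setT (u ^~ i)) ->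
  measurable_fun setT (fun x => f (u x)).
Proof.
move=> mf mu; rewrite (_ : (fun x => f (u x)) =
  (fun t : #|I|.-tuple R => f (fun i => tnth t (enum_rank i))) \o
  (fun x => [tuple u x (enum_val k) | k < #|I|])).
  apply: measurableT_comp => //; apply/measurable_fun_tnthP => k.
  rewrite (_ : _ \o _ = u ^~ (enum_val k))//.
  by apply/funext => x /=; rewrite tnth_mktuple.
apply/funext => x /=; congr f; apply/funext => i.
by rewrite tnth_mktuple enum_rankK.
Qed.

Lemma fun_measurable_map f (u : (I -> R) -> (I -> R)) :
  fun_measurable f ->
  (forall i, fun_measurable (fun z => (u z i)%:E)) ->
  fun_measurable (f \o u).
Proof.
move=> mf mu.
apply: (fun_measurable_comp _ _ f
  (fun t : #|I|.-tuple R => u (fun x => tnth t (enum_rank x)))) => // i.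
by have /measurable_EFinP := mu i.
Qed.

Lemma fun_measurable_addl c f :
  fun_measurable f -> fun_measurable (fun z => f (fun i => c i + z i)%R).
Proof.
move=> mf; apply: (fun_measurable_map _ (fun z i => c i + z i)%R) => // i.
apply/measurable_EFinP; apply: measurable_funD => //; exact: measurable_tnth.
Qed.

Lemma fun_measurable_weight s c :
  fun_measurable (fun z => (gauss_weight s c z)%:E).
Proof.
apply/measurable_EFinP; apply: measurable_prod => i _.
apply: measurableT_comp => //; apply: measurable_funB => //.
by apply: measurable_funM => //; exact: measurable_tnth.
Qed.

Lemma gauss_weight_ge0 s c z : (0 <= gauss_weight s c z)%R.
Proof. by apply: prodr_ge0 => i _; exact: expR_ge0. Qed.

Lemma gauss_iter_ge0 s f z : (forall z, 0 <= f z) -> 0 <= gauss_iter I s f z.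
Proof.
by move=> f0; elim: s z => //= i s IH z; apply: integral_ge0 => x _.
Qed.

(** Tonelli makes each partial integral measurable, because the integrand is jointly measurable in
    the old point and the new value at [i]. *)
Lemma fun_measurable_gauss_iter s f : (forall z, 0 <= f z) ->
  fun_measurable f -> fun_measurable (gauss_iter I s f).
Proof.
move=> f0 mf; elim: s => //= i s IH.
pose F (p : #|I|.-tuple R * measurableTypeR R) := gauss_iter I s f
  (fun j => if j == i then p.2 else tnth p.1 (enum_rank j)).
apply: (@measurable_fun_fubini_tonelli_F _ _ _ _ _ N01 F).
  rewrite /F; apply: fun_measurable_comp => // j.
  case: (j == i) => /=; first exact: measurable_snd.
  apply: (@measurableT_comp _ _ _ _ _ _ (fun t => tnth t (enum_rank j))) => //.
  exact: measurable_tnth.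
by move=> p; exact: gauss_iter_ge0.
Qed.

Lemma measurable_gauss_iter_upd s f z i : (forall z, 0 <= f z) ->
  fun_measurable f ->
  measurable_fun [set: R] (fun t : R => gauss_iter I s f (upd z i t)).
Proof.
move=> f0 mf; apply: (fun_measurable_comp _ _ (gauss_iter I s f)) => [|j].
  exact: fun_measurable_gauss_iter.
by rewrite /upd; case: (j == i).
Qed.

Lemma eq_gauss_iter s f g : f =1 g -> gauss_iter I s f = gauss_iter I s g.
Proof. by move=> /funext ->. Qed.

Lemma gauss_iterD s f g z : (forall z, 0 <= f z) -> (forall z, 0 <= g z) ->
  fun_measurable f -> fun_measurable g ->
  gauss_iter I s (fun y => f y + g y) z
  = gauss_iter I s f z + gauss_iter I s g z.
Proof.
move=> f0 g0 mf mg; elim: s z => //= i s IH z.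
under eq_integral do rewrite IH.
rewrite ge0_integralD//; do ?[by move=> *; exact: gauss_iter_ge0];
  exact: measurable_gauss_iter_upd.
Qed.

Lemma le_gauss_iter s f g z : (forall z, 0 <= f z) ->
  fun_measurable f -> fun_measurable g -> (forall z, f z <= g z) ->
  gauss_iter I s f z <= gauss_iter I s g z.
Proof.
move=> f0 mf mg fg; elim: s z => //= i s IH z.
have g0 y : 0 <= g y by exact: le_trans (f0 y) (fg y).
apply: ge0_le_integral => //; do ?[by move=> *; exact: gauss_iter_ge0];
  exact: measurable_gauss_iter_upd.
Qed.

Lemma gauss_iter_cst s (r : R) z : gauss_iter I s (cst r%:E) z = r%:E.
Proof.
elim: s z => //= i s IH z; under eq_integral do rewrite IH.
by rewrite integral_cst//= probability_setT mule1.
Qed.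

(** [k] ignores every coordinate being integrated, so it is a constant factor of each integral. *)
Lemma gauss_iterMr s f (k : (I -> R) -> R) z : (forall z, 0 <= f z) ->
  fun_measurable f -> (forall z, 0 <= k z)%R ->
  (forall y i t, i \in s -> k (upd y i t) = k y) ->
  gauss_iter I s (fun y => f y * (k y)%:E) z = gauss_iter I s f z * (k z)%:E.
Proof.
move=> f0 mf k0; elim: s z => //= i s IH z ks.
under eq_integral => t _.
  rewrite IH; last by move=> y j u js; rewrite ks// inE js orbT.
  rewrite -/(upd z i t) ks ?mem_head//; over.
rewrite ge0_integralZr//; do ?[by move=> *; exact: gauss_iter_ge0].
- exact: measurable_gauss_iter_upd.
- by rewrite lee_fin.
Qed.

(** [u] commutes with every update made by the integrals, so it may be applied once to the starting
    point instead. *)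
Lemma gauss_iter_comp s f (u : (I -> R) -> I -> R) z :
  (forall y i t, i \in s -> u (upd y i t) = upd (u y) i t) ->
  gauss_iter I s (f \o u) z = gauss_iter I s f (u z).
Proof.
elim: s z => //= i s IH z us; apply: eq_integral => t _.
rewrite IH; last by move=> y j v js; rewrite us// inE js orbT.
by rewrite -/(upd z i t) us// mem_head.
Qed.

(** Cameron-Martin formula by induction on [s]: the one-dimensional formula treats the head
    coordinate, the induction hypothesis the tail, and [uniq s] keeps the two from interfering. *)
Lemma gauss_iter_shift s f c z : uniq s -> (forall z, 0 <= f z) ->
  fun_measurable f ->
  gauss_iter I s
    (fun y => f (fun i => y i + (if i \in s then c i else 0))%R) z
  = gauss_iter I s (fun y => f y * (gauss_weight s c y)%:E) z.
Proof.
elim: s f z => [|i s IH] f z /=.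
  move=> _ _ _; rewrite /gauss_weight big_nil mule1; congr f.
  by apply/funext => j; rewrite addr0.
move=> /andP[iNs us] f0 mf.
pose sh (y : I -> R) : I -> R := fun j => (y j + (if j == i then c j else 0))%R.
have msh j : fun_measurable (fun y => (sh y j)%:E).
  apply/measurable_EFinP; apply: measurable_funD => //; exact: measurable_tnth.
have w0 s' y : 0 <= f y * (gauss_weight s' c y)%:E.
  by rewrite mule_ge0// lee_fin gauss_weight_ge0.
have mw s' : fun_measurable (fun y => f y * (gauss_weight s' c y)%:E).
  by apply: emeasurable_funM => //; exact: fun_measurable_weight.
pose h t := gauss_iter I s (fun y => f y * (gauss_weight s c y)%:E)
  (upd z i t).
(* Both sides equal this integral: the right one by the one-dimensional formula in [t], the left one
   by shifting the tail. *)
transitivity (\int[N01]_t h (t + c i)%R); last first.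
  rewrite ge0_integral_normal_prob_shift//; first last.
  - by move=> t; exact: gauss_iter_ge0.
  - exact: measurable_gauss_iter_upd.
  apply: eq_integral => t _; rewrite /h.
  (* The head factor reads only coordinate [i], which is not in [s], so it moves inside the tail
     integral. *)
  pose k (y : I -> R) := expR (c i * y i - c i ^+ 2 / 2).
  rewrite [X in X%:E](_ : _ = k (upd z i t)); last first.
    by rewrite /k /upd eqxx.
  rewrite -(gauss_iterMr _ _ k)//; first last.
  - move=> y j u js; rewrite /k /upd; case: eqVneq => // ij.
    by rewrite ij js in iNs.
  - by move=> y; exact: expR_ge0.
  rewrite (eq_gauss_iter _ _ (fun y => f y * (gauss_weight (i :: s) c y)%:E))//.
  by move=> y; rewrite -muleA -EFinM /gauss_weight big_cons mulrC.
apply: eq_integral => t _; rewrite /h.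
have -> : upd z i (t + c i)%R = sh (upd z i t).
  apply/funext => j; rewrite /sh /upd; case: eqVneq => [->//|_].
  by rewrite addr0.
rewrite -[RHS]gauss_iter_comp; last first.
  move=> y j u js; apply/funext => l; rewrite /sh /upd.
  case: (eqVneq l j) => // ->; case: eqVneq => [ji|]; last by rewrite addr0.
  by rewrite -ji js in iNs.
transitivity (gauss_iter I s
   (fun y => (f \o sh) y * (gauss_weight s c y)%:E) (upd z i t)).
  rewrite -IH//; last 2 first.
  - by move=> y; exact: f0.
  - exact: fun_measurable_map.
  rewrite (eq_gauss_iter _ _ (fun y => (f \o sh)
    (fun j => (y j + (if j \in s then c j else 0))%R)))// => y /=.
  congr f; apply/funext => j; rewrite /sh inE -addrA; congr (_ + _)%R.
  case: eqVneq => [->|_] /=; last by rewrite addr0.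
  by rewrite (negbTE iNs) add0r.
(* The tail weight reads no coordinate changed by [sh]. *)
congr (gauss_iter I s _ _); apply/funext => y /=; congr (_ * _%:E).
apply: eq_big_seq => j js; rewrite /sh; case: eqVneq => [ji|].
  by rewrite -ji js in iNs.
by rewrite addr0.
Qed.

Lemma gauss_iter_sum (J : Type) (r : seq J) s (F : J -> (I -> R) -> \bar R) z :
  (forall j z, 0 <= F j z) -> (forall j, fun_measurable (F j)) ->
  gauss_iter I s (fun y => \sum_(j <- r) F j y) z
  = \sum_(j <- r) gauss_iter I s (F j) z.
Proof.
move=> F0 mF; elim: r => [|j r IH].
  rewrite big_nil -[RHS](gauss_iter_cst s 0 z).
  by congr (gauss_iter I s _ _); apply/funext => y; rewrite big_nil.
rewrite big_cons -IH -gauss_iterD//.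
- by congr (gauss_iter I s _ _); apply/funext => y; rewrite big_cons.
- by move=> y; exact: sume_ge0.
- exact: emeasurable_sum.
Qed.

Lemma gaussE_shift f c : (forall z, 0 <= f z) -> fun_measurable f ->
  gaussE I (fun y => f (fun i => c i + y i)%R)
  = gaussE I (fun y => f y * (gauss_weight (enum I) c y)%:E).
Proof.
move=> f0 mf; rewrite /gaussE -gauss_iter_shift ?enum_uniq//.
congr (gauss_iter I _ _ _); apply/funext => y; congr f; apply/funext => i.
by rewrite mem_enum addrC.
Qed.

(** Completing the square, the squared weight for [c] is exp(|c|^2) times the weight for [2 c], and
    every weight has mean 1. *)
Lemma gaussE_weight_sqr c :
  gaussE I (fun y => (gauss_weight (enum I) c y ^+ 2)%:E)
  = (expR (\sum_i c i ^+ 2))%:E.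
Proof.
pose K := expR (\sum_i c i ^+ 2).
pose c2 i := (2 * c i)%R.
have -> : (fun y => (gauss_weight (enum I) c y ^+ 2)%:E) =
    (fun y => (gauss_weight (enum I) c2 y)%:E * K%:E).
  apply/funext => y; rewrite -EFinM; congr _%:E.
  rewrite /gauss_weight /K -big_enum/= expR_sum -prodrXl -big_split/=.
  apply: eq_bigr => i _; rewrite -expRD -expRM_natl; congr expR.
  by rewrite /c2; field.
rewrite /gaussE (gauss_iterMr _ _ (fun=> K))//.
- rewrite [X in X * _](_ : _ = 1) ?mul1e//.
  (* Mean 1 of the weight is the shift formula applied to the constant function 1. *)
  rewrite -[RHS](gauss_iter_cst (enum I) 1 (fun=> 0%R)).
  have := gaussE_shift (cst 1) c2 (fun=> lee01) (measurable_cst _).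
  rewrite /gaussE => ->; congr (gauss_iter I _ _ _).
  by apply/funext => y; rewrite mul1e.
- by move=> y; rewrite lee_fin gauss_weight_ge0.
- exact: fun_measurable_weight.
- by move=> _; exact: expR_ge0.
Qed.

End GaussianExpectation.

(** * Minimax lower bound from finitely many candidates around a base mean *)

Section MinimaxLowerBound.
Context {R : realType} {I S : finType}.
Local Open Scope ereal_scope.

Lemma estimator_measurable (phi : (I -> R) -> S -> R) (s : S) :
  estimator I S phi -> fun_measurable (fun y => (phi y s)%:E).
Proof. by case=> _ _ /(_ s) mphi; apply/measurable_EFinP. Qed.

Lemma estimator_le1 (phi : (I -> R) -> S -> R) y s :
  estimator I S phi -> (phi y s <= 1)%R.
Proof.
case=> phi0 phi1 _; rewrite -(phi1 y) (bigD1 s)//= lerDl.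
by apply: sumr_ge0 => *; exact: phi0.
Qed.

Lemma err_probD (phi : (I -> R) -> S -> R) (X : I -> R) (s : S) :
  estimator I S phi ->
  err_prob I S phi X s + gaussE I (fun z => (phi (fun x => X x + z x)%R s)%:E)
  = 1.
Proof.
move=> est; have [phi0 phi1 _] := est.
have mphi t : fun_measurable (fun z => (phi (fun x => X x + z x)%R t)%:E).
  apply: (fun_measurable_addl X (fun y => (phi y t)%:E)).
  exact: estimator_measurable.
rewrite /err_prob /gaussE -gauss_iterD//.
- rewrite -[RHS](gauss_iter_cst (enum I) 1 (fun=> 0%R)).
  congr (gauss_iter I _ _ _); apply/funext => z.
  by rewrite -EFinD -(phi1 (fun x => X x + z x)%R) [in RHS](bigD1 s)//= addrC.
- by move=> z; rewrite lee_fin; apply: sumr_ge0.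
- by move=> z; rewrite lee_fin.
- apply/measurable_EFinP; under eq_fun do rewrite -big_filter.
  apply: measurable_sum => t.
  by have /measurable_EFinP := mphi t.
Qed.

(** The constant guess [s0] is an estimator and each of its error probabilities is at most 1. The
    point [s0] matters: with [S] empty there is no estimator and the infimum is infinite. *)
Lemma minimax_risk_le1 (cls : set ((I -> R) * S)) (s0 : S) :
  minimax_risk cls <= 1.
Proof.
pose phi := fun (_ : I -> R) s => (s == s0)%:R%R : R.
have est : estimator I S phi.
  split=> [y s|y|s] //.
  rewrite (bigD1 s0)//= /phi eqxx big1 ?addr0// => s /negbTE ->//.
apply: (@le_trans _ _ (ereal_sup [set err_prob I S phi p.1 p.2 | p in cls])).
  by apply: ereal_inf_lbound; exists phi.
apply: ge_ereal_sup => _ [p _ <-].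
rewrite -(err_probD phi p.1 p.2 est) leeDl//.
by apply: gauss_iter_ge0 => z; rewrite lee_fin ler0n.
Qed.

(* AM-GM: the likelihood ratio w satisfies w <= t / 2 + w ^ 2 / (2 t). *)
Lemma correct_prob_le (phi : (I -> R) -> S -> R) (B D : I -> R) (s : S) (t : R) :
  estimator I S phi -> (0 < t)%R ->
  gaussE I (fun z => (phi (fun x => B x + D x + z x)%R s)%:E) <=
  (t / 2)%:E * gaussE I (fun z => (phi (fun x => B x + z x)%R s)%:E)
  + (expR (\sum_i D i ^+ 2) / (2 * t))%:E.
Proof.
move=> est t0; have [phi0 _ _] := est.
pose F y := (phi (fun x => B x + y x)%R s)%:E.
have F0 y : 0 <= F y by rewrite lee_fin.
have mF : fun_measurable F.
  apply: (fun_measurable_addl B (fun y => (phi y s)%:E)).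
  exact: estimator_measurable.
pose w := gauss_weight (enum I) D.
have mw : fun_measurable (fun z => (w z)%:E) by exact: fun_measurable_weight.
have mw2 : fun_measurable (fun z => (w z ^+ 2)%:E).
  by apply/measurable_EFinP/measurable_funX; have /measurable_EFinP := mw.
(* Change of measure: the extra mean [D] is traded for the likelihood ratio [w]. *)
have -> : gaussE I (fun z => (phi (fun x => B x + D x + z x)%R s)%:E) =
    gaussE I (fun z => F z * (w z)%:E).
  rewrite -gaussE_shift//; congr (gaussE I _); apply/funext => z.
  by rewrite /F; congr (phi _ s)%:E; apply/funext => x; rewrite addrA.
have t20 : (0 <= t / 2)%R by rewrite divr_ge0// ltW.
have t2V0 : (0 <= (2 * t)^-1)%R by rewrite invr_ge0 mulr_ge0// ltW.
rewrite (EFinM (expR _)) -gaussE_weight_sqr muleC /gaussE.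
rewrite -(gauss_iterMr _ _ (fun=> (t / 2)%R))//.
rewrite -(gauss_iterMr _ _ (fun=> (2 * t)^-1%R))//; last first.
  by move=> z; rewrite lee_fin sqr_ge0.
rewrite -gauss_iterD//; last 4 first.
- by move=> z; rewrite mule_ge0// lee_fin.
- by move=> z; rewrite mule_ge0// lee_fin sqr_ge0.
- exact: emeasurable_funM.
- exact: emeasurable_funM.
apply: le_gauss_iter.
- by move=> z; rewrite mule_ge0// lee_fin gauss_weight_ge0.
- exact: emeasurable_funM.
- by apply: emeasurable_funD; exact: emeasurable_funM.
- move=> z; rewrite /F -!EFinM -EFinD lee_fin.
  have := phi0 (fun x => B x + z x)%R s.
  have := estimator_le1 phi (fun x => B x + z x)%R s est.
  set p := phi _ _ => p1 p0.
  (* Here p <= 1 allows the factor p in front of w^2 to be dropped; the slack is an explicit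
     nonnegative expression. *)
  rewrite -subr_ge0.
  have -> : (p * (t / 2) + w z ^+ 2 / (2 * t) - p * w z =
     (p * (t - w z) ^+ 2 + (1 - p) * w z ^+ 2) / (2 * t))%R.
    by field; rewrite gt_eqF.
  by rewrite mulr_ge0// addr_ge0// mulr_ge0// ?sqr_ge0// subr_ge0.
Qed.

(** [B] is only a reference mean and may lie outside [cls]; in the applications its set in one mode
    has one element too few or too many. *)
Lemma minimax_risk_ge (J : finType) (cls : set ((I -> R) * S)) (B : I -> R)
    (D : J -> I -> R) (sg : J -> S) (v : R) :
  (0 < #|J|)%N -> injective sg ->
  (forall j, \sum_i D j i ^+ 2 <= v)%R ->
  (forall j, cls ((fun i => B i + D j i)%R, sg j)) ->
  (1 - expR (v / 2) / Num.sqrt #|J|%:R)%:E <= minimax_risk cls.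
Proof.
move=> /card_gt0P[j0 _] inj Dv clsJ.
have N0 : (0 < #|J|%:R :> R)%R by rewrite ltr0n; apply/card_gt0P; exists j0.
apply: le_ereal_inf_tmp => _ [phi /= est <-].
have [phi0 phi1 _] := est.
pose F j y := (phi (fun x => B x + y x)%R (sg j))%:E.
have F0 j y : 0 <= F j y by rewrite lee_fin.
have mF j : fun_measurable (F j).
  apply: (fun_measurable_addl B (fun y => (phi y (sg j))%:E)).
  exact: estimator_measurable.
pose q j := gaussE I (F j).
have q0 j : 0 <= q j by exact: gauss_iter_ge0.
(* By injectivity of [sg] the guesses [sg j] are mutually exclusive, so their probabilities under
   [B] sum to at most 1. *)
have sumq : \sum_j q j <= 1.
  rewrite /q /gaussE -gauss_iter_sum//.
  rewrite -[leRHS](gauss_iter_cst (enum I) 1 (fun=> 0%R)).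
  apply: le_gauss_iter => //.
  - by move=> z; exact: sume_ge0.
  - exact: emeasurable_sum.
  - exact: measurable_cst.
  move=> z; rewrite /F sumEFin lee_fin -(phi1 (fun x => B x + z x)%R).
  pose p s := phi (fun x => B x + z x)%R s.
  pose A := [set sg j | j in J]%SET.
  rewrite (_ : (\sum_j p (sg j) = \sum_(s in A) p s)%R); last first.
    by rewrite /A (big_imset _ (in2W inj)).
  rewrite [leRHS](bigID (mem A))/= lerDl.
  by apply: sumr_ge0 => *; exact: phi0.
have qfin j : q j \is a fin_num.
  rewrite ge0_fin_numE// (@le_lt_trans _ _ 1) ?ltry//.
  by apply: le_trans sumq; rewrite (bigD1 j)//= leeDl// sume_ge0.
(* The smallest [q j] is at most the average. *)
have [j qj] : exists j, (#|J|%:R * fine (q j) <= 1)%R.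
  exists [arg min_(j < j0) fine (q j)]%O.
  rewrite -lee_fin; apply: le_trans sumq.
  under eq_bigr do rewrite -(fineK (qfin _)).
  rewrite sumEFin lee_fin mulr_natl -sumr_const.
  by apply: ler_sum => i _; case: arg_minP => // k _; exact.
(* The minimizer of t / (2 N) + exp v / (2 t), where both terms equal exp (v / 2) / (2 sqrt N). *)
set t := (expR (v / 2) * Num.sqrt #|J|%:R)%R.
have s0 : (0 < Num.sqrt #|J|%:R :> R)%R by rewrite sqrtr_gt0.
have t0 : (0 < t)%R by rewrite mulr_gt0 ?expR_gt0.
apply: (@le_trans _ _ (err_prob I S phi (fun i => B i + D j i)%R (sg j))).
  rewrite EFinB leeBlDr// -(err_probD phi (fun i => B i + D j i)%R (sg j) est).
  rewrite leeD2l//.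
  apply: (le_trans (correct_prob_le phi B (D j) (sg j) t est t0)).
  rewrite -/(q j) -(fineK (qfin j)) -EFinM -EFinD lee_fin.
  apply: (@le_trans _ _ (t / 2 * #|J|%:R^-1 + expR v / (2 * t))%R).
    apply: lerD.
      rewrite ler_pM2l ?divr_gt0//; rewrite mulrC in qj.
      by rewrite -ler_pdivlMr// mul1r in qj.
    by rewrite ler_pM2r ?invr_gt0 ?mulr_gt0 ?expR_gt0// ler_expR.
  have -> : expR v = (expR (v / 2) ^+ 2)%R.
    by rewrite -expRM_natl; congr expR; field.
  move: (sqr_sqrtr (ltW N0)); rewrite /t; move: s0.
  move: (Num.sqrt _) (expR_gt0 (v / 2)) => r e0 r0 <-.
  rewrite le_eqVlt; apply/orP; left; apply/eqP.
  by field; rewrite !gt_eqF.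
by apply: ereal_sup_ubound; exists ((fun i => B i + D j i)%R, sg j).
Qed.

End MinimaxLowerBound.

(** * Supports differing in one element, and the embedding of CHC into ROHC *)

Section ClusterFamilies.
Context {R : realType} {d : nat}.
Implicit Types (n k : 'I_d -> nat) (lam l : R).

Lemma prod_nat_bool (I : finType) (b : pred I) :
  \prod_i ((b i)%:R : R) = [forall i, b i]%:R.
Proof.
have [/forallP bT|/forallPn[i bi]] := boolP [forall i, b i].
  by rewrite big1// => i _; rewrite bT.
by rewrite (bigD1 i)//= (negbTE bi) mul0r.
Qed.

Lemma sqrtr_prod (I : Type) (r : seq I) (F : I -> R) : (forall i, 0 <= F i) ->
  Num.sqrt (\prod_(i <- r) F i) = \prod_(i <- r) Num.sqrt (F i).
Proof.
move=> F0; elim: r => [|i r IH]; first by rewrite !big_nil sqrtr1.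
by rewrite !big_cons sqrtrM// IH.
Qed.

Lemma minimax_riskS {I S : finType} (c1 c2 : set ((I -> R) * S)) :
  c1 `<=` c2 -> (minimax_risk c1 <= minimax_risk c2)%E.
Proof.
move=> c12; apply: le_ereal_inf_tmp => _ [phi est <-].
apply: (@le_trans _ _ (ereal_sup [set err_prob I S phi p.1 p.2 | p in c1])).
  by apply: ereal_inf_lbound; exists phi.
by apply: ereal_sup_le => _ [p c1p <-]; exists p => //; exact: c12.
Qed.

(** [A j] and [B i] differ at most at [y j], so the tensor changes only on the slab of cells with
    x_i = [y j] and x_z in [B z] otherwise. This slab has prod_(z != i) k_z cells, each changing by
    at most |l|. *)
Lemma chc_risk_ge n k lam l (i : 'I_d) (J : finType) (B : forall z, {set 'I_(n z)})
    (A : J -> {set 'I_(n i)}) (y : J -> 'I_(n i)) :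
  lam <= l -> (0 < #|J|)%N -> injective A ->
  (forall z, z != i -> #|B z| = k z) -> (forall j, #|A j| = k i) ->
  (forall j x, x != y j -> (x \in A j) = (x \in B i)) ->
  ((1 - expR (l ^+ 2 * \prod_(z < d | z != i) (k z)%:R / 2)
        / Num.sqrt #|J|%:R)%:E
   <= minimax_risk (chc_class d n k lam))%E.
Proof.
move=> laml J0 Ainj cB cA Ay.
pose sg j : tsupp d n := [ffun z => dfwith B i (A j) z].
pose ind (S : forall z, {set 'I_(n z)}) (x : tidx d n) : R :=
  l * \prod_(z < d) (x z \in S z)%:R.
have indE S x : ind S x = l * (x \in setXn S)%:R.
  by rewrite /ind prod_nat_bool in_setXn.
apply: (minimax_risk_ge J _ (ind B) (fun j x => ind (sg j) x - ind B x) sg).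
- exact: J0.
- by move=> j1 j2 /ffunP/(_ i); rewrite !ffunE !dfwithin => /Ainj.
- move=> j; pose D := setXn (dfwith B i [set y j]%SET).
  apply: (@le_trans _ _ (\sum_x l ^+ 2 * (x \in D)%:R)).
    apply: ler_sum => x _; rewrite !indE -mulrBr exprMn ler_wpM2l ?sqr_ge0//.
    have [xD|xND] := boolP (x \in D).
      by case: (_ \in setXn _); case: (_ \in setXn _);
        rewrite ?subrr ?subr0 ?sub0r ?sqrrN ?expr1n ?expr0n.
    (* Off the slab, either x_i differs from [y j], where [A j] and [B i] agree, or another
       coordinate leaves its set and both indicators vanish. *)
    suff -> : (x \in setXn (sg j)) = (x \in setXn B) by rewrite subrr expr0n.
    have [xB|xNB] := boolP [forall z, (z != i) ==> (x z \in B z)].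
      have xy : x i != y j.
        apply: contraNneq xND => xy; apply/setXnP => z.
        have [->|zi] := eqVneq z i; first by rewrite dfwithin xy finset.in_set1.
        by rewrite dfwithout 1?eq_sym//; have /forallP/(_ z) := xB; rewrite zi.
      apply/setXnP/setXnP => xS z; have := xS z.
        have [->|zi] := eqVneq z i; first by rewrite ffunE dfwithin Ay.
        by rewrite ffunE dfwithout 1?eq_sym.
      have [->|zi] := eqVneq z i; first by rewrite ffunE dfwithin Ay.
      by rewrite ffunE dfwithout 1?eq_sym.
    move: xNB => /forallPn[z]; rewrite negb_imply => /andP[zi xz].
    have /negbTE -> : x \notin setXn B.
      by apply: contra xz => /setXnP.
    apply/negbTE; apply: contra xz => /setXnP/(_ z).
    by rewrite ffunE dfwithout 1?eq_sym.
  rewrite -mulr_sumr ler_wpM2l ?sqr_ge0// -natr_sum -big_mkcond/= sum1_card.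
  rewrite cardsXn (bigD1 i)//= dfwithin cards1 mul1n natr_prod le_eqVlt.
  apply/orP; left; apply/eqP; apply: eq_bigr => z zi.
  by rewrite dfwithout 1?eq_sym// cB.
- move=> j; exists l, (sg j); split => //.
    move=> z; rewrite ffunE; have [->|zi] := eqVneq z i.
      by rewrite dfwithin.
    by rewrite dfwithout 1?eq_sym// cB.
  by congr (_, _); apply/funext => x; rewrite subrKC.
Qed.

Lemma card_ord_lt m c : (c <= m)%N -> #|[set x : 'I_m | (x < c)%N]%SET| = c.
Proof.
move=> cm; rewrite -sum1_card -[RHS]card_ord -sum1_card.
rewrite -(big_mkord xpredT (fun=> 1%N)) (big_nat_widen _ _ _ _ _ cm)/=.
by rewrite big_mkord; apply: eq_bigl => x; rewrite inE.
Qed.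

(** The base set in mode [i] has k_i - 1 elements, and each candidate adds one of the n_i - k_i + 1
    points outside it. *)
Lemma chc_risk_ge_insert n k lam l (i : 'I_d) : lam <= l ->
  (0 < k i)%N -> (forall z, k z <= n z)%N ->
  ((1 - expR (l ^+ 2 * \prod_(z < d | z != i) (k z)%:R / 2)
        / Num.sqrt (n i - k i).+1%:R)%:E
   <= minimax_risk (chc_class d n k lam))%E.
Proof.
move=> laml ki kn.
pose c z := if z == i then (k i).-1 else k z.
pose B z := [set x : 'I_(n z) | (x < c z)%N]%SET.
have cB z : #|B z| = c z.
  by rewrite card_ord_lt// /c; case: eqP => // ->; rewrite (leq_trans (leq_pred _)).
pose J := {x : 'I_(n i) | x \notin B i}.
have cJ : #|{: J}| = (n i - k i).+1.
  rewrite card_sig (_ : #|_| = #|(~: B i)%SET|).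
    by rewrite cardsCs finset.setCK card_ord cB /c eqxx; have := kn i; lia.
  by apply: eq_card => x; rewrite !inE.
rewrite -cJ.
apply: (chc_risk_ge n k lam l i _ B (fun j : J => (val j |: B i)%SET) val) => //.
- by rewrite cJ.
- move=> [x xB] [y yB] /= /setP/(_ x);
  rewrite !finset.in_setU !finset.in_set1 eqxx/=.
  rewrite (negbTE xB) orbF => /esym/eqP xy; exact: val_inj.
- by move=> z zi; rewrite cB /c (negbTE zi).
- by move=> [x xB]; rewrite cardsU1 xB cB /c eqxx add1n prednK.
- by move=> [x xB] y /= yx; rewrite finset.in_setU1 (negbTE yx).
Qed.

(* Covers k close to n: regime (A2) allows n - k to stay bounded. *)
Lemma chc_risk_ge_delete n k lam l (i : 'I_d) : lam <= l ->
  (k i < n i)%N -> (forall z, k z <= n z)%N ->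
  ((1 - expR (l ^+ 2 * \prod_(z < d | z != i) (k z)%:R / 2)
        / Num.sqrt (k i).+1%:R)%:E
   <= minimax_risk (chc_class d n k lam))%E.
Proof.
move=> laml ki kn.
(* One element too many in mode [i]: deleting any of the k_i + 1 elements gives a candidate. *)
pose c z := if z == i then (k i).+1 else k z.
pose B z := [set x : 'I_(n z) | (x < c z)%N]%SET.
have cB z : #|B z| = c z by rewrite card_ord_lt// /c; case: eqP => // ->.
pose J := {x : 'I_(n i) | x \in B i}.
have cJ : #|{: J}| = (k i).+1.
  by rewrite card_sig -[LHS]/#|B i| cB /c eqxx.
rewrite -cJ.
apply: (chc_risk_ge n k lam l i _ B (fun j : J => (B i :\ val j)%SET) val) => //.
- by rewrite cJ.
- move=> [x xB] [y yB] /= /setP/(_ x); rewrite !finset.in_setD1 eqxx/= xB andbT.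
  by move=> /esym/negbFE/eqP xy; exact: val_inj.
- by move=> z zi; rewrite cB /c (negbTE zi).
- move=> [x xB] /=; have := cardsD1 x (B i).
  by rewrite xB cB {1}/c eqxx add1n => -[].
- by move=> [x xB] y /= yx; rewrite finset.in_setD1 yx.
Qed.

Lemma chc_sub_rohc n k (C mu : R) : 1 <= C -> (forall z, 0 < k z)%N ->
  chc_class d n k (mu / Num.sqrt (\prod_(z < d) (k z)%:R))
  `<=` rohc_class d n k C mu.
Proof.
move=> C1 k0 _ [l [J [laml cJ ->]]].
have sk0 z : 0 < Num.sqrt (k z)%:R :> R by rewrite sqrtr_gt0 ltr0n.
have P0 : 0 < Num.sqrt (\prod_(z < d) (k z)%:R) :> R.
  by rewrite sqrtr_gt0 prodr_gt0// => z _; rewrite ltr0n.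
(* Normalized indicators: unit vectors whose nonzero entries sit at the lower end of the range
   allowed by [Vset]. *)
pose v z x : R := (x \in J z)%:R / Num.sqrt (k z)%:R.
have vE z x : (v z x != 0) = (x \in J z).
  rewrite /v mulf_eq0 invr_eq0 (gt_eqF (sk0 z)) orbF pnatr_eq0 eqb0.
  by rewrite negbK.
exists (l * Num.sqrt (\prod_(z < d) (k z)%:R)), v; split.
- by rewrite -ler_pdivrMr.
- move=> z; split.
  + transitivity (\sum_(x in J z) ((k z)%:R^-1 : R)).
      rewrite [RHS]big_mkcond/=; apply: eq_bigr => x _.
      rewrite /v exprMn exprVn sqr_sqrtr ?ler0n//.
      by case: (_ \in _); rewrite ?mul0r ?mul1r ?expr1n ?expr0n ?mul0r ?mul1r.
    by rewrite sumr_const cJ -[LHS]mulr_natl mulfV// pnatr_eq0 -lt0n.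
  + rewrite (_ : [set x | v z x != 0]%SET = J z) ?cJ//.
    by apply/setP => x; rewrite inE vE.
  + move=> x; rewrite vE /v => ->; rewrite mul1r ger0_norm ?invr_ge0 ?sqrtr_ge0//.
    by rewrite lexx/= ler_peMl ?invr_ge0 ?sqrtr_ge0.
- congr (_, _).
    apply/funext => x; rewrite -mulrA; congr (_ * _); rewrite /v big_split/=.
    rewrite mulrCA -[LHS]mulr1; congr (_ * _).
    rewrite prodfV sqrtr_prod; last by move=> z; rewrite ler0n.
    by rewrite mulfV// prodf_seq_neq0; apply/allP => z _; rewrite gt_eqF.
  by apply/ffunP => z; rewrite ffunE; apply/setP => x; rewrite inE vE.
Qed.

Lemma chc_risk_le_rohc_risk n k (C mu : R) : 1 <= C ->
  (forall z, 0 < k z)%N ->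
  (minimax_risk (chc_class d n k (mu / Num.sqrt (\prod_(z < d) (k z)%:R)))
   <= minimax_risk (rohc_class d n k C mu))%E.
Proof. by move=> C1 k0; apply: minimax_riskS; exact: chc_sub_rohc. Qed.

End ClusterFamilies.

(** * Limits in regimes (A1) and (A2) *)

Section Asymptotics.
Context {R : realType} {d : nat}.
Implicit Types (n k : 'I_d -> nat) (a : R).

Lemma Mmin_le n k (i : 'I_d) : (Mmin d n k <= n i - k i)%N.
Proof.
rewrite /Mmin; move: (\max_(_ < d) _)%N (mem_index_enum i) => x.
elim: (index_enum _) => // j r IH; rewrite big_cons inE geq_min.
by move=> /orP[/eqP ->|/IH ->]; rewrite ?leqnn ?orbT.
Qed.

Lemma le_Mmin n k (A : nat) : (0 < d)%N ->
  (forall i : 'I_d, A <= n i - k i)%N -> (A <= Mmin d n k)%N.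
Proof.
move=> d0 nk; rewrite /Mmin; elim/big_ind: _ => [|x y Ax Ay|i _] //.
(* The minimum is folded from the largest gap, which dominates the gap of mode 0. *)
- by apply: leq_trans (nk (Ordinal d0)) _; exact: leq_bigmax.
- by rewrite leq_min Ax.
Qed.

Lemma ln_nat_cvgy {X : nat -> nat} :
  X @ \oo --> \oo -> (ln ((X m)%:R : R)) @[m --> \oo] --> +oo.
Proof.
move=> /cvgnyPge Xy; apply/cvgryPge => A.
near=> m.
have XA : expR A <= (X m)%:R :> R.
  rewrite (le_trans (ltW (truncnS_gt _)))// ler_nat.
  by near: m; exact: Xy.
by rewrite -[A]expRK ler_ln// posrE ?expR_gt0// (lt_le_trans _ XA)// expR_gt0.
Unshelve. all: by end_near. Qed.

Lemma sqrt_nat_cvgy {X : nat -> nat} :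
  X @ \oo --> \oo -> Num.sqrt ((X m)%:R : R) @[m --> \oo] --> +oo.
Proof.
move=> /cvgnyPge Xy; apply/cvgryPge => A.
near=> m.
have XA : A ^+ 2 <= (X m)%:R :> R.
  rewrite (le_trans (ltW (truncnS_gt _)))// ler_nat.
  by near: m; exact: Xy.
by rewrite (le_trans (ler_norm _))// -sqrtr_sqr ler_sqrt.
Unshelve. all: by end_near. Qed.

Lemma cvgy_inv {X : nat -> R} :
  X @ \oo --> +oo -> (X m)^-1 @[m --> \oo] --> (0 : R).
Proof.
move=> Xy; have X0 : \forall m \near \oo, 0 < X m by have /cvgryPgt := Xy; exact.
exact: (gtr0_cvgV0 X0).2.
Qed.

Lemma risk_lb_cvg a (M : nat -> nat) : M @ \oo --> \oo ->
  risk_lb a (M m)%:R @[m --> \oo] --> 1 - 2 * a.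
Proof.
move=> My.
have lnM := cvgy_inv (ln_nat_cvgy My).
have sqM : (1 + Num.sqrt ((M m)%:R : R))^-1 @[m --> \oo] --> (0 : R).
  apply: cvgy_inv; apply/cvgryPge => A.
  have /cvgryPge/(_ A) := sqrt_nat_cvgy My.
  by apply: filterS => m /le_trans; apply; rewrite lerDr.
(* Written as 1 - 1 / (1 + sqrt M), the first factor shows its limit. *)
have -> : (fun m => risk_lb a (M m)%:R) =
  (fun m => (1 - (1 + Num.sqrt (M m)%:R)^-1)
            * (1 - 2 * a - 2 * a * (ln (M m)%:R)^-1)).
  apply/funext => m; rewrite /risk_lb; congr (_ * _).
  have s0 : 0 < 1 + Num.sqrt (M m)%:R :> R.
    by rewrite ltr_pwDl// sqrtr_ge0.
  by field; rewrite gt_eqF.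
rewrite -[X in _ --> X]mul1r; apply: cvgM.
  by rewrite -[X in _ --> X]subr0; apply: cvgB => //; exact: cvg_cst.
rewrite -[X in _ --> X]subr0; apply: cvgB; first exact: cvg_cst.
by rewrite -[X in _ --> X](mulr0 (2 * a)); apply: cvgMl_tmp.
Qed.

Lemma risk_lb_le a (M : R) : 0 < a -> a < 1 / 8 -> 1 < M ->
  risk_lb a M <= 1 - 2 * a.
Proof.
move=> a0 a8 M1; rewrite /risk_lb.
have s0 := sqrtr_ge0 M.
have s1 : Num.sqrt M / (1 + Num.sqrt M) <= 1.
  by rewrite ler_pdivrMr ?mul1r ?lerDr// ltr_pwDl.
have p0 : 0 <= Num.sqrt M / (1 + Num.sqrt M).
  by rewrite divr_ge0// addr_ge0.
have l0 : 0 <= 2 * a / ln M by rewrite divr_ge0 ?ln_ge0 ?mulr_ge0 ?ltW.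
set p := _ / (1 + _) in s1 p0 *; set q := 2 * a / _ in l0 *.
nra.
Qed.

(** Eventually k / n < 1 / 2, so n - k is at least n / 2; with finitely many modes this holds for
    all of them at once. *)
Lemma regimeA1_gap (n k : nat -> 'I_d -> nat) : regimeA1 R d n k ->
  forall A : nat, \forall m \near \oo, forall i : 'I_d,
    [/\ (0 < k m i)%N, (k m i <= n m i)%N & (A <= n m i - k m i)%N].
Proof.
move=> reg A; apply: filter_forall => i.
have [/cvgnyPge ny /cvgnyPge ky kn] := reg i.
near=> m.
have n0 : (0 < n m i)%N by near: m; exact: ny.
have nA : (A.*2 <= n m i)%N by near: m; exact: ny.
have k0 : (0 < k m i)%N by near: m; exact: ky.
have kn2 : (k m i)%:R / (n m i)%:R < 2^-1 :> R.
  by near: m; apply: (cvgr_lt 0 kn).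
have : ((k m i).*2 < n m i)%N.
  rewrite -(ltr_nat R) -muln2 natrM.
  move: kn2; rewrite ltr_pdivrMr ?ltr0n//; lra.
by rewrite -!muln2 => ?; split; lia.
Unshelve. all: by end_near. Qed.

Lemma thresh_attained n k a (lam : R) : (0 < d)%N -> lam <= thresh d n k a ->
  exists i : 'I_d, lam <=
    Num.sqrt (a * ln (n i - k i)%N%:R / \prod_(z < d | z != i) (k z)%:R).
Proof.
move=> d0; rewrite /thresh; pose f (i : 'I_d) : R := Num.sqrt
  (a * ln (n i - k i)%N%:R / \prod_(z < d | z != i) (k z)%:R).
have f0 (i : 'I_d) : xpredT i -> 0 <= f i by rewrite sqrtr_ge0.
by have [i _ ->] := eq_bigmax (Ordinal d0) xpredT f isT f0; exists i.
Qed.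

(** With N = n_i - k_i, the loss is at most N^((a - 1) / 2). It is below 2 a because -ln (2 a) <= ln
    M / 4 <= ln N / 4 and (1 - a) / 2 > 1 / 4. *)
Lemma chc_risk_ge_risk_lb n k a (lam : R) :
  (0 < d)%N -> 0 < a -> a < 1 / 8 -> lam <= thresh d n k a ->
  (forall i : 'I_d, 0 < k i)%N -> (forall i : 'I_d, k i <= n i)%N ->
  (1 < Mmin d n k)%N -> - 4 * ln (2 * a) <= ln (Mmin d n k)%:R ->
  ((risk_lb a (Mmin d n k)%:R)%:E <= minimax_risk (chc_class d n k lam))%E.
Proof.
move=> d0 a0 a8 lamt k0 kn M1 Ma; have [i lami] := thresh_attained _ _ _ _ d0 lamt.
(* The amplitude is the threshold of mode [i] itself, allowed since the class contains every
   amplitude above [lam]; it makes v exactly a ln N. *)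
apply: le_trans (chc_risk_ge_insert _ _ _ _ i lami (k0 i) kn).
set P := \prod_(z < d | z != i) _; set N := (n i - k i)%N.
have P0 : 0 < P by rewrite prodr_gt0// => z _; rewrite ltr0n.
have N1 : (1 < N)%N by rewrite (leq_trans M1)// Mmin_le.
have lN0 : 0 <= ln (N%:R : R) by rewrite ln_ge0// ler1n ltnW.
rewrite sqr_sqrtr; last by rewrite divr_ge0 ?mulr_ge0// ltW.
rewrite divfK ?gt_eqF// lee_fin.
apply: (le_trans (risk_lb_le _ _ a0 a8 _)); first by rewrite ltr1n.
rewrite lerD2l lerN2 ler_pdivrMr ?sqrtr_gt0 ?ltr0n//.
have sN : expR (ln N%:R / 2) <= Num.sqrt N.+1%:R :> R.
  have -> : expR (ln N%:R / 2) = Num.sqrt (N%:R : R).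
    rewrite -[in RHS](@lnK _ N%:R) ?posrE ?ltr0n 1?ltnW//.
    have -> : ln (N%:R : R) = 2 * (ln N%:R / 2) by field.
    by rewrite expRM_natl sqrtr_sqr ger0_norm ?expR_ge0// mulrC mulKf.
  by rewrite ler_sqrt ?ler_nat.
apply: (@le_trans _ _ (2 * a * expR (ln N%:R / 2))); last first.
  by rewrite ler_wpM2l// mulr_ge0 ?ltW.
rewrite -[2 * a]lnK ?posrE ?mulr_gt0// -expRD ler_expR.
have : ln (Mmin d n k)%:R <= ln (N%:R : R).
  by rewrite ler_ln ?posrE ?ltr0n ?ler_nat ?Mmin_le// ltnW.
by move: Ma lN0; move: (ln _) (ln _) (ln _) => x y z; nra.
Qed.

Lemma chc_regimeA1 a (n k : nat -> 'I_d -> nat) (lam : nat -> R) :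
  (0 < d)%N -> 0 < a -> a < 1 / 8 -> regimeA1 R d n k ->
  (\forall m \near \oo, lam m <= thresh d (n m) (k m) a) ->
  (\forall m \near \oo,
     ((risk_lb a (Mmin d (n m) (k m))%:R)%:E
       <= minimax_risk (chc_class d (n m) (k m) (lam m)))%E)
  /\ (fun m => risk_lb a (Mmin d (n m) (k m))%:R) @ \oo --> 1 - 2 * a.
Proof.
move=> d0 a0 a8 reg lamt.
have My : (fun m => Mmin d (n m) (k m)) @ \oo --> \oo.
  apply/cvgnyPge => A; have := regimeA1_gap _ _ reg A.
  by apply: filterS => m h; apply: le_Mmin => // i; have [] := h i.
split; last exact: risk_lb_cvg.
have gap := regimeA1_gap _ _ reg 0.
have /cvgryPge lnM := ln_nat_cvgy My.
have /cvgnyPge My' := My.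
near=> m.
have h : forall i, [/\ (0 < k m i)%N, (k m i <= n m i)%N &
  (0 <= n m i - k m i)%N] by near: m; exact: gap.
apply: chc_risk_ge_risk_lb => //.
- by near: m.
- by move=> i; have [] := h i.
- by move=> i; have [] := h i.
- by near: m; exact: My'.
- by near: m; exact: lnM.
Unshelve. all: by end_near. Qed.

(** On the scale of ln n, the exponent of v = lam^2 k^(d - 1) tends to (d - 1) alpha - 2 beta < 0,
    so v <= 1 eventually. *)
Lemma chc_regimeA2 (alpha beta : R) (nn nc kc : nat -> nat) (lam : nat -> R) :
  (0 < d)%N -> nn @ \oo --> \oo ->
  (forall m, 0 < kc m < nc m)%N ->
  (fun m => ln ((nc m)%:R : R) / ln (nn m)%:R) @ \oo --> (1 : R) ->
  (fun m => ln (kc m)%:R / ln (nn m)%:R) @ \oo --> alpha ->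
  (forall m, 0 < lam m) ->
  (fun m => ln (lam m)^-1 / ln (nn m)%:R) @ \oo --> beta ->
  d.-1%:R * alpha / 2 < beta ->
  (fun m => minimax_risk
    (chc_class d (fun _ : 'I_d => nc m) (fun _ => kc m) (lam m))) @ \oo --> 1%E.
Proof.
move=> d0 nny kn ncl kcl lam0 laml ab.
(* Size of the larger of the insertion and deletion families; it exceeds half of [nc m] and so
   diverges. *)
pose N m := (maxn (nc m - kc m) (kc m)).+1.
have /cvgryPge lny := ln_nat_cvgy nny.
have Ny : N @ \oo --> \oo.
  apply/cvgnyPge => A.
  have h1 : 2^-1 < 1 :> R by lra.
  have nc1 := cvgr_gt _ ncl _ h1.
  near=> m.
  have L0 : 1 <= ln ((nn m)%:R : R) by near: m; exact: lny.
  have LA : 2 * ln ((A.+1).*2%:R : R) <= ln ((nn m)%:R : R) by near: m; exact: lny.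
  have : 2^-1 < ln ((nc m)%:R : R) / ln (nn m)%:R.
    by near: m; exact: nc1.
  rewrite ltr_pdivlMr; last by rewrite (lt_le_trans _ L0).
  move=> ncL; have : ln ((A.+1).*2%:R : R) <= ln (nc m)%:R by lra.
  have nc0 : (0 < nc m)%N by have /andP[_] := kn m; exact: leq_ltn_trans.
  rewrite ler_ln ?posrE ?ltr0n ?double_gt0// ler_nat /N -muln2 => Anc.
  by have /andP[_ knm] := kn m; lia.
have sN := cvgy_inv (sqrt_nat_cvgy Ny).
apply: (@squeeze_cvge _ _ _ _
  (fun m => (1 - expR (1 / 2) * (Num.sqrt (N m)%:R)^-1)%:E) _ (fun=> 1%E)).
(* A positive limit gives ln (1 / lam) > (d - 1) / 2 * ln k eventually, which is v < 1 in
   logarithmic form. *)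
- have ab' : 0 < beta - d.-1%:R / 2 * alpha by lra.
  have diff := cvgr_gt _ (cvgB laml (cvgMl_tmp (a := d.-1%:R / 2) kcl)) 0 ab'.
  near=> m.
  have L0 : 1 <= ln ((nn m)%:R : R) by near: m; exact: lny.
  have : 0 < ln (lam m)^-1 / ln (nn m)%:R
             - d.-1%:R / 2 * (ln (kc m)%:R / ln ((nn m)%:R : R)).
    by near: m; exact: diff.
  have Lp : 0 < ln ((nn m)%:R : R) by rewrite (lt_le_trans _ L0).
  rewrite mulrA -mulrBl pmulr_lgt0 ?invr_gt0//.
  rewrite lnV ?posrE// => lk.
  have /andP[k0 knm] := kn m.
  pose i0 : 'I_d := Ordinal d0.
  have V1 : lam m ^+ 2 * \prod_(z < d | z != i0) (kc m)%:R <= 1.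
    rewrite prodr_const cardC1 card_ord.
    rewrite -[leRHS]expR0 -[leLHS]lnK ?posrE ?mulr_gt0 ?exprn_gt0 ?ltr0n//.
    rewrite ler_expR lnM ?posrE ?exprn_gt0 ?ltr0n//.
    rewrite !lnXn ?ltr0n// -(mulr_natl _ d.-1) -(mulr_natl _ 2).
    move: lk; move: (ln _) (ln _) (d.-1%:R : R) => x y z; nra.
  pose s0 : tsupp d (fun=> nc m) := [ffun i : 'I_d => finset.set0].
  rewrite (minimax_risk_le1 _ s0) andbT.
  have e1 (c : nat) : 1 - expR (1 / 2) * (Num.sqrt c.+1%:R)^-1 <=
      1 - expR (lam m ^+ 2 * \prod_(z < d | z != i0) (kc m)%:R / 2)
          / Num.sqrt c.+1%:R.
    rewrite lerD2l lerN2 ler_wpM2r ?invr_ge0 ?sqrtr_ge0// ler_expR.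
    by rewrite ler_wpM2r.
  rewrite /N; case: (leqP (nc m - kc m) (kc m)) => _.
    apply: le_trans (chc_risk_ge_delete (fun=> nc m) (fun=> kc m) _ _ i0
      (lexx (lam m)) knm (fun=> ltnW knm)).
    by rewrite lee_fin; exact: e1.
  apply: le_trans (chc_risk_ge_insert (fun=> nc m) (fun=> kc m) _ _ i0
    (lexx (lam m)) k0 (fun=> ltnW knm)).
  by rewrite lee_fin; exact: e1.
- apply: cvg_EFin; first exact: nearW.
  rewrite -[X in _ --> X]subr0; apply: cvgB; first exact: cvg_cst.
  by rewrite -[X in _ --> X](mulr0 (expR (1 / 2))); apply: cvgMl_tmp.
- exact: cvg_cst.
Unshelve. all: by end_near. Qed.

End Asymptotics.

(** * The four claims, with ROHC reduced to CHC by rescaling the amplitude *)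

Theorem mainTheorem1 (R : realType) (d : nat) (a : R) :
  (2 <= d)%N -> 0 < a < 1 / 8 ->
  (* CHC_R, regime (A1) *)
  (forall (n k : nat -> 'I_d -> nat) (lam : nat -> R),
     regimeA1 R d n k ->
     (\forall m \near \oo, lam m <= thresh d (n m) (k m) a) ->
     (\forall m \near \oo,
        ((risk_lb a (Mmin d (n m) (k m))%:R)%:E
           <= minimax_risk (chc_class d (n m) (k m) (lam m)))%E)
     /\ (fun m => risk_lb a (Mmin d (n m) (k m))%:R) @ \oo --> 1 - 2 * a) /\
  (* ROHC_R, regime (A1) *)
  (forall (C : R) (n k : nat -> 'I_d -> nat) (mu : nat -> R),
     1 < C ->
     regimeA1 R d n k ->
     (\forall m \near \oo,
        mu m / Num.sqrt (\prod_(i < d) (k m i)%:R) <= thresh d (n m) (k m) a) ->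
     (\forall m \near \oo,
        ((risk_lb a (Mmin d (n m) (k m))%:R)%:E
           <= minimax_risk (rohc_class d (n m) (k m) C (mu m)))%E)
     /\ (fun m => risk_lb a (Mmin d (n m) (k m))%:R) @ \oo --> 1 - 2 * a) /\
  (* CHC_R, regime (A2) *)
  (forall (alpha beta : R) (nn nc kc : nat -> nat) (lam : nat -> R),
     0 <= alpha <= 1 ->
     nn @ \oo --> \oo ->
     (forall m, 0 < kc m < nc m)%N ->
     (fun m => ln ((nc m)%:R : R) / ln (nn m)%:R) @ \oo --> (1 : R) ->
     (fun m => ln (kc m)%:R / ln (nn m)%:R) @ \oo --> alpha ->
     (forall m, 0 < lam m) ->
     (fun m => ln (lam m)^-1 / ln (nn m)%:R) @ \oo --> beta ->
     d.-1%:R * alpha / 2 < beta ->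
     (fun m => minimax_risk
                 (chc_class d (fun _ : 'I_d => nc m) (fun _ => kc m) (lam m)))
       @ \oo --> 1%E) /\
  (* ROHC_R, regime (A2) *)
  (forall (C alpha beta : R) (nn nc kc : nat -> nat) (mu : nat -> R),
     1 < C ->
     0 <= alpha <= 1 ->
     nn @ \oo --> \oo ->
     (forall m, 0 < kc m < nc m)%N ->
     (fun m => ln ((nc m)%:R : R) / ln (nn m)%:R) @ \oo --> (1 : R) ->
     (fun m => ln (kc m)%:R / ln (nn m)%:R) @ \oo --> alpha ->
     (forall m, 0 < mu m) ->
     (fun m => ln (Num.sqrt ((kc m)%:R ^+ d) / mu m) / ln (nn m)%:R)
       @ \oo --> beta ->
     d.-1%:R * alpha / 2 < beta ->
     (fun m => minimax_risk
                 (rohc_class d (fun _ : 'I_d => nc m) (fun _ => kc m) C (mu m)))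
       @ \oo --> 1%E).
Proof.
move=> d2 /andP[a0 a8]; have d0 : (0 < d)%N by exact: ltnW.
split; first by move=> n k lam; exact: chc_regimeA1.
split.
  move=> C n k mu C1 reg mut.
  have [H1 H2] := chc_regimeA1 a n k
    (fun m => mu m / Num.sqrt (\prod_(i < d) (k m i)%:R)) d0 a0 a8 reg mut.
  split=> //; have gap := regimeA1_gap _ _ reg 0.
  apply: filterS2 H1 gap => m h1 h2; apply: le_trans h1 _.
  by apply: chc_risk_le_rohc_risk; [exact: ltW|move=> z; have [] := h2 z].
split.
  by move=> alpha beta nn nc kc lam _ *; exact: (chc_regimeA2 alpha beta nn).
move=> C alpha beta nn nc kc mu C1 _ nny kn ncl kcl mu0 mul ab.
have P0 m : 0 < Num.sqrt ((kc m)%:R ^+ d) :> R.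
  by rewrite sqrtr_gt0 exprn_gt0// ltr0n; have /andP[] := kn m.
(* With this amplitude 1 / lam = sqrt (k^d) / mu, so both classes have the same exponent [beta]. *)
pose lam m := mu m / Num.sqrt ((kc m)%:R ^+ d).
have H : (fun m => minimax_risk
    (chc_class d (fun _ : 'I_d => nc m) (fun _ => kc m) (lam m))) @ \oo --> 1%E.
  apply: (chc_regimeA2 alpha beta nn) => //.
    by move=> m; rewrite divr_gt0.
  by under eq_fun do rewrite invf_div.
(* The ROHC risk lies between the CHC risk and 1. *)
apply: (squeeze_cvge _ H (cvg_cst 1%E)); apply: nearW => m.
pose s0 : tsupp d (fun=> nc m) := [ffun i : 'I_d => finset.set0].
rewrite (minimax_risk_le1 _ s0) andbT.
have := @chc_risk_le_rohc_risk R d (fun=> nc m) (fun=> kc m) C (mu m) (ltW C1).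
by rewrite prodr_const card_ord; apply=> _; have /andP[] := kn m.
Qed.
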